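(* Let $R$ be a zero-dimensional ring (in particular, $R$ may be any von Neumann regular ring) and $\mathcal{A}\subseteq \mathrm{Spec}(R)$. Then $\mathcal{A}$ has the P.A-property if and only if $\mathcal{A}$ is compact (equivalently, $\mathcal{A}$ is closed, i.e., $\mathcal{A}=V(I)$ for some ideal $I$ of $R$).
   Context: All rings are commutative with $1\neq 0$. A set $\mathcal{A}\subseteq \mathrm{Spec}(R)$ has the P.A-property (prime avoidance property) if whenever an ideal $I$ of $R$ satisfies $I\subseteq\bigcup_{P\in\mathcal{A}}P$, there exists $P\in\mathcal{A}$ with $I\subseteq P$. $V(I)$ is the set of prime ideals of $R$ containing $I$. Zero-dimensional means Krull dimension zero. $\mathcal{A}$ carries the subspace topology of the Zariski topology on $\mathrm{Spec}(R)$; compact means every open cover has a finite subcover (no Hausdorff condition). *)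

(* Defs.v *)
From HB Require Import structures.
From mathcomp Require Import all_boot all_order all_algebra.
From mathcomp Require Import boolp classical_sets topology.

Set Implicit Arguments.
Unset Strict Implicit.
Unset Printing Implicit Defensive.

Import GRing.Theory.

Local Open Scope classical_set_scope.
Local Open Scope ring_scope.

(* Ideals are Prop-valued and may be the whole ring. The structure [idealr] of
   ring_quotient is not used because it only describes proper ideals, whereas
   the empty set is V(I) only for I = R. *)
Definition is_ideal (R : comNzRingType) (I : set R) : Prop :=
  [/\ I 0, forall x y, I x -> I y -> I (x + y) & forall a x, I x -> I (a * x)].

Definition is_prime_ideal (R : comNzRingType) (P : set R) : Prop :=
  [/\ is_ideal P, ~ P 1 & forall x y, P (x * y) -> P x \/ P y].

Record Spec (R : comNzRingType) : Type := MkSpec {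
  prime_set :> set R;
  prime_setP : is_prime_ideal prime_set
}.

Definition zariski_V (R : comNzRingType) (I : set R) : set (Spec R) :=
  [set P : Spec R | I `<=` P].

Definition zariski_open (R : comNzRingType) (U : set (Spec R)) : Prop :=
  exists2 I : set R, is_ideal I & U = ~` zariski_V I.

Lemma zariski_openT (R : comNzRingType) : zariski_open [set: Spec R].
Proof.
exists setT => //; apply/seteqP; split => // P _ /= TP.
by case: (prime_setP P) => _ + _; apply; exact: TP.
Qed.

Lemma zariski_openI (R : comNzRingType) : setI_closed (@zariski_open R).
Proof.
move=> _ _ [I [I0 ID IM] ->] [J [J0 JD JM] ->].
exists (I `&` J).
  split=> //; first by move=> x y [Ix Jx] [Iy Jy]; split; [exact: ID|exact: JD].
  by move=> a x [Ix Jx]; split; [exact: IM|exact: JM].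
rewrite -setCU; congr (~` _); apply/seteqP; split=> P.
  by case=> /= sP x [Ix Jx]; exact: sP.
move=> /= IJP; apply: contrapT => /not_orP[/existsNP[x /not_implyP[Ix nPx]]].
move=> /existsNP[y /not_implyP[Jy nPy]].
have [_ _ /(_ x y)] := prime_setP P.
by case=> //; apply: IJP; split; [rewrite mulrC; exact: IM|exact: JM].
Qed.

Lemma zariski_open_bigcup (R : comNzRingType) (T : Type)
    (f : T -> set (Spec R)) :
  (forall i, zariski_open (f i)) -> zariski_open (\bigcup_i f i).
Proof.
move=> /(_ _)/cid2 of_; pose J i := s2val (of_ i).
pose above (K : set R) := is_ideal K /\ forall i, J i `<=` K.
exists [set x | forall K, above K -> K x].
  split=> [K [[]]//|x y Ix Iy K aK|a x Ix K aK]; have [[_ KD KM] _] := aK.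
    by apply: KD; [exact: Ix|exact: Iy].
  by apply: KM; exact: Ix.
have fE i : f i = ~` zariski_V (J i) by exact: s2valP' (of_ i).
apply/seteqP; split=> P.
  case=> i _; rewrite fE /= => + IP; apply => x Jx.
  by apply: IP => K [_ /(_ i)]; apply.
move=> nIP; apply: contrapT => nP; apply: nIP => x; apply; split.
  by have [] := prime_setP P.
move=> i; apply: contrapT => nJP; apply: nP; exists i => //.
by rewrite fE.
Qed.

HB.instance Definition _ (R : comNzRingType) := gen_eqMixin (Spec R).
HB.instance Definition _ (R : comNzRingType) := gen_choiceMixin (Spec R).
HB.instance Definition _ (R : comNzRingType) :=
  isOpenTopological.Build (Spec R) (@zariski_openT R) (@zariski_openI R)
    (@zariski_open_bigcup R).

Definition PA_property (R : comNzRingType) (A : set (Spec R)) : Prop :=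
  forall I : set R, is_ideal I ->
    I `<=` \bigcup_(P in A) (P : set R) -> exists2 P : Spec R, A P & I `<=` P.

(* A chain P_0 < ... < P_n, of length n. *)
Definition prime_chain (R : comNzRingType) (n : nat) : Prop :=
  exists p : 'I_n.+1 -> Spec R,
    forall i j : 'I_n.+1, (i < j)%N -> p i `<` p j.

Definition has_krull_dim (R : comNzRingType) (n : nat) : Prop :=
  prime_chain R n /\ forall m, prime_chain R m -> (m <= n)%N.

Definition zero_dimensional_ring (R : comNzRingType) : Prop := has_krull_dim R 0.

Definition von_neumann_regular (R : comNzRingType) : Prop :=
  forall a : R, exists x : R, a = a * x * a.

(* Main.v *)
Require Import Defs.
From HB Require Import structures.
From mathcomp Require Import all_boot all_order all_algebra.
From mathcomp Require Import boolp classical_sets filter topology.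
From mathcomp Require Import ring.

(** The whole statement rests on one reformulation of zero-dimensionality: each
    element [a] has a complement [b], meaning that every prime contains exactly
    one of [a] and [b] ([zero_dimensional_complemented]). In a zero-dimensional
    ring no prime avoids the multiplicative set of all [a ^+ n * (1 - a * x)]:
    such a prime [Q] would not contain [a], while [Q + (a)] would be proper, so
    a maximal ideal would lie strictly above [Q]. Hence
    [a ^+ n * (1 - a * x) = 0] for some [n] and [x], and [b := 1 - a * x] works.
    In a von Neumann regular ring [a = a * x * a] gives this at once, and
    complements forbid strict inclusions between primes
    ([complemented_spec_eq]).

    Complements make each basic open set D(a) clopen, so Spec(R) is Hausdorff
    and its compact subsets are closed. Conversely V(I) is compact in any ring,
    since an ultrafilter [F] on Spec(R) converges to the prime of all [a] lying
    in [F]-almost every prime ([zariski_V_compact]).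

    For prime avoidance, V(J) has the property in any ring, as an ideal [I]
    covered by primes of V(J) cannot be comaximal with [J]
    ([zariski_V_PA_property]). In the other direction, let [A] have the
    property and let the prime [M] contain the intersection of [A]. If some [a]
    in [M] avoided every prime of [A], its complement would lie in all of them,
    hence in [M], which is absurd. So [M] is covered by [A], hence contained in,
    and by dimension zero equal to, a member of [A]
    ([complemented_PA_zariski_V]). *)

Set Implicit Arguments.
Unset Strict Implicit.
Unset Printing Implicit Defensive.

Import GRing.Theory.
Local Open Scope classical_set_scope.
Local Open Scope ring_scope.

(** * Ideals and existence of primes *)

Definition ideal_sum (R : comNzRingType) (I J : set R) : set R :=
  [set x | exists2 i, I i & exists2 j, J j & x = i + j].

Definition principal_ideal (R : comNzRingType) (a : R) : set R :=
  [set x | exists r, x = r * a].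

Lemma ideal_sum_ideal (R : comNzRingType) (I J : set R) :
  is_ideal I -> is_ideal J -> is_ideal (ideal_sum I J).
Proof.
move=> [I0 ID IM] [J0 JD JM]; split.
- by exists 0 => //; exists 0; rewrite ?addr0.
- move=> _ _ [i Ii [j Jj ->]] [k Ik [l Jl ->]].
  exists (i + k); first exact: ID.
  by exists (j + l); [exact: JD | rewrite addrACA].
- move=> a _ [i Ii [j Jj ->]].
  exists (a * i); first exact: IM.
  by exists (a * j); [exact: JM | rewrite mulrDr].
Qed.

Lemma ideal_sum_subl (R : comNzRingType) (I J : set R) :
  is_ideal J -> I `<=` ideal_sum I J.
Proof. by move=> [J0 _ _] x Ix; exists x => //; exists 0; rewrite ?addr0. Qed.

Lemma ideal_sum_subr (R : comNzRingType) (I J : set R) :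
  is_ideal I -> J `<=` ideal_sum I J.
Proof. by move=> [I0 _ _] x Jx; exists 0 => //; exists x; rewrite ?add0r. Qed.

Lemma principal_ideal_ideal (R : comNzRingType) (a : R) :
  is_ideal (principal_ideal a).
Proof.
split; first by exists 0; rewrite mul0r.
- by move=> _ _ [r ->] [s ->]; exists (r + s); rewrite mulrDl.
- by move=> b _ [r ->]; exists (b * r); rewrite mulrA.
Qed.

Lemma mem_principal_ideal (R : comNzRingType) (a : R) : principal_ideal a a.
Proof. by exists 1; rewrite mul1r. Qed.

Lemma set0_ideal (R : comNzRingType) : is_ideal [set (0 : R)].
Proof.
split=> //= [x y -> ->|a x ->]; first exact: addr0.
exact: mulr0.
Qed.

Lemma ideal_bigcup_chain (R : comNzRingType) (F : set (set R)) (K : set R) :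
  F K -> F `<=` [set I | is_ideal I] -> total_on F subset ->
  is_ideal (\bigcup_(I in F) I).
Proof.
move=> FK Fid Ftot; split.
- by exists K => //; have [] := Fid _ FK.
- move=> x y [I FI Ix] [J FJ Jy].
  have [IJ|JI] := Ftot _ _ FI FJ.
    by exists J => //; have [_ JD _] := Fid _ FJ; apply: JD => //; exact: IJ.
  by exists I => //; have [_ ID _] := Fid _ FI; apply: ID => //; exact: JI.
- by move=> a x [I FI Ix]; exists I => //; have [_ _ IM] := Fid _ FI; exact: IM.
Qed.

(** An ideal containing [I] and maximal among those avoiding a multiplicative
    set [S] is prime: if [x] and [y] lie outside it, adjoining either one
    reaches [S], and so does the product of the two elements reached. *)
Lemma exists_prime_avoiding (R : comNzRingType) (S I : set R) :
  S 1 -> (forall x y, S x -> S y -> S (x * y)) ->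
  is_ideal I -> (forall x, I x -> ~ S x) ->
  exists2 P : Spec R, I `<=` P & forall x, prime_set P x -> ~ S x.
Proof.
move=> S1 SM Iid IS.
pose good (X : set R) :=
  [/\ is_ideal X, I `<=` X & forall x, X x -> ~ S x].
(* The empty set is admitted because it is the union of the empty chain. *)
have [F FG Ftot|M [MG Mmax]] := @Zorn_bigcup R [set X | X !=set0 -> good X].
  move=> [x [K0 FK0 K0x]].
  pose G : set (set R) := [set X | F X /\ X !=set0].
  have -> : \bigcup_(X in F) X = \bigcup_(X in G) X.
    apply/seteqP; split=> y [X FX Xy].
      by exists X => //; split=> //; exists y.
    by exists X => //; case: FX.
  have GG X : G X -> good X by case=> /FG + X0; apply.
  have GK0 : G K0 by split=> //; exists x.
  split.
  - apply: (@ideal_bigcup_chain _ _ K0) => //.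
      by move=> X /GG[].
    by move=> X Y [FX _] [FY _]; exact: Ftot.
  - by move=> y Iy; exists K0 => //; have [_ + _] := GG _ GK0; apply.
  - by move=> y [X /GG[_ _ XS] Xy]; exact: XS.
have Igood : good I by split.
have I0 : I 0 by case: Iid.
have M0 : M !=set0.
  apply/set0P/eqP => ME; apply: (Mmax I) => //; rewrite ME; split=> //.
  by move=> /(_ _ I0).
have [Mid IM MS] := MG M0.
have [_ MD MM] := Mid.
have adjoin x : ~ M x -> exists2 s, S s & ideal_sum M (principal_ideal x) s.
  move=> nMx; apply: contrapT => nS.
  pose N := ideal_sum M (principal_ideal x).
  have MN : M `<=` N by apply: ideal_sum_subl; exact: principal_ideal_ideal.
  apply: (Mmax N).
    split=> // NM; apply/nMx/NM/ideal_sum_subr => //.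
    exact: mem_principal_ideal.
  move=> _; split.
  - by apply: ideal_sum_ideal => //; exact: principal_ideal_ideal.
  - by apply: subset_trans MN.
  - by move=> s Ns Ss; apply: nS; exists s.
have Mprime : is_prime_ideal M.
  split=> //; first by move=> /MS; apply.
  move=> x y Mxy; apply: contrapT => /not_orP[nMx nMy].
  have [s Ss [m Mm [_ [r ->] sE]]] := adjoin _ nMx.
  have [t St [m' Mm' [_ [r' ->] tE]]] := adjoin _ nMy.
  apply: MS (SM _ _ Ss St); rewrite sE tE.
  have -> : (m + r * x) * (m' + r' * y)
            = (m' + r' * y) * m + (r * x * m' + r * r' * (x * y)) by ring.
  by apply: (MD); [exact: MM | apply: MD; exact: MM].
by exists (MkSpec Mprime).
Qed.

Lemma exists_prime_above (R : comNzRingType) (I : set R) :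
  is_ideal I -> ~ I 1 -> exists P : Spec R, I `<=` P.
Proof.
move=> Iid I1.
have [|||x Ix xE|P IP _] := @exists_prime_avoiding R [set 1] I => //.
- by move=> _ _ -> ->; rewrite /= mulr1.
- by apply: I1; rewrite -xE.
- by exists P.
Qed.

Lemma Spec_inhabited (R : comNzRingType) : exists P : Spec R, True.
Proof.
have [|P _] := @exists_prime_above R [set 0] (@set0_ideal R); last by exists P.
by move=> /eqP; rewrite oner_eq0.
Qed.

Lemma Spec_eq (R : comNzRingType) (P Q : Spec R) :
  prime_set P = prime_set Q -> P = Q.
Proof.
case: P Q => [P Pp] [Q Qp] /= PQ; case: _ / PQ Qp => Qp.
by rewrite (Prop_irrelevance Pp Qp).
Qed.

(** * Complements and Krull dimension zero *)

(** Every basic open set D(a) is also of the form V(b), hence clopen. *)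
Definition complemented (R : comNzRingType) : Prop :=
  forall a : R, exists b : R,
    forall P : Spec R, prime_set P b <-> ~ prime_set P a.

Lemma complemented_spec_eq (R : comNzRingType) (P Q : Spec R) :
  complemented R -> P `<=` Q -> P = Q.
Proof.
move=> cR PQ; apply/Spec_eq/seteqP; split=> // a Qa.
apply: contrapT => nPa; have [b bP] := cR a.
by have /bP := PQ _ ((bP P).2 nPa); apply.
Qed.

Lemma prime_pow (R : comNzRingType) (P : Spec R) (a : R) n :
  prime_set P (a ^+ n) -> prime_set P a.
Proof.
have [_ P1 Pm] := prime_setP P.
by elim: n => [/P1 //|n IHn]; rewrite exprS => /Pm[].
Qed.

(** Both dimension zero and von Neumann regularity produce complements through
    this relation. *)
Lemma pi_regular_complement (R : comNzRingType) (a x : R) n :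
  a ^+ n * (1 - a * x) = 0 ->
  forall P : Spec R, prime_set P (1 - a * x) <-> ~ prime_set P a.
Proof.
move=> ax0 P; have [[P0 PD PM] P1 Pm] := prime_setP P; split.
  move=> Pb Pa; apply: P1; rewrite -(subrK (a * x) 1) mulrC.
  by apply: PD; [rewrite mulrC | exact: PM].
move=> nPa; have /Pm[/prime_pow //|//] : prime_set P (a ^+ n * (1 - a * x)).
by rewrite ax0.
Qed.

Lemma von_neumann_regular_complemented (R : comNzRingType) :
  von_neumann_regular R -> complemented R.
Proof.
move=> vR a; have [x ax] := vR a.
exists (1 - a * x); apply: (@pi_regular_complement R a x 1).
by rewrite expr1 mulrBr mulr1 mulrA mulrAC -ax subrr.
Qed.

Lemma complemented_zero_dimensional (R : comNzRingType) :
  complemented R -> zero_dimensional_ring R.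
Proof.
move=> cR; split.
  have [P _] := Spec_inhabited R.
  by exists (fun=> P) => i j; rewrite !ord1.
case=> // m [p pP].
have [pq qp] : p ord0 `<` p ord_max by apply: pP.
by case: qp; rewrite -(complemented_spec_eq cR pq).
Qed.

Lemma zero_dimensional_spec_eq (R : comNzRingType) (P Q : Spec R) :
  zero_dimensional_ring R -> P `<=` Q -> P = Q.
Proof.
move=> [_ dimR] PQ; apply/Spec_eq/seteqP; split=> //.
apply: contrapT => nQP.
suff /dimR : prime_chain R 1 by [].
exists (fun i : 'I_2 => if i == ord0 then P else Q).
by move=> [[|[|i]] ip] [[|[|j]] jp] //= _; split.
Qed.

Lemma zero_dimensional_complemented (R : comNzRingType) :
  zero_dimensional_ring R -> complemented R.
Proof.
move=> zR a.
pose S : set R := [set s | exists n x, s = a ^+ n * (1 - a * x)].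
suff [n [x /esym ax0]] : S 0.
  by exists (1 - a * x); exact: pi_regular_complement ax0.
apply: contrapT => nS0.
have [|||_ -> //|Q _ QS] := @exists_prime_avoiding R S [set 0].
- by exists 0%N, 0; rewrite expr0 mulr0 subr0 mulr1.
- move=> _ _ [n [x ->]] [m [y ->]].
  by exists (n + m)%N, (x + y - a * x * y); rewrite exprD; ring.
- exact: set0_ideal.
have Qid : is_ideal Q by case: (prime_setP Q).
pose J := ideal_sum Q (principal_ideal a).
have [||M JM] := @exists_prime_above R J.
- by apply: ideal_sum_ideal => //; exact: principal_ideal_ideal.
- move=> [q Qq [_ [r ->] E]]; apply: (QS q) => //.
  by exists 0%N, r; rewrite expr0 mul1r E [r * a]mulrC addrK.
have QM : Q `<=` M.
  by apply: subset_trans JM; apply: ideal_sum_subl; exact: principal_ideal_ideal.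
have Qa : prime_set Q a.
  rewrite (zero_dimensional_spec_eq zR QM); apply/JM/ideal_sum_subr => //.
  exact: mem_principal_ideal.
by apply: (QS a) => //; exists 1%N, 0; rewrite expr1 mulr0 subr0 mulr1.
Qed.

(** * The Zariski topology *)

Lemma zariski_closedP (R : comNzRingType) (A : set (Spec R)) :
  closed A <-> exists2 I : set R, is_ideal I & A = zariski_V I.
Proof.
rewrite -openC; split=> -[I Iid E]; exists I => //.
  by rewrite -[A]setCK E setCK.
by rewrite E.
Qed.

Lemma basic_open_open (R : comNzRingType) (a : R) :
  open [set P : Spec R | ~ prime_set P a].
Proof.
exists (principal_ideal a); first exact: principal_ideal_ideal.
apply/seteqP; split=> P /=; first by move=> nPa /(_ _ (mem_principal_ideal a)).
move=> naP Pa; apply: naP => _ [r ->].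
by have [[_ _ PM] _ _] := prime_setP P; exact: PM.
Qed.

Lemma complemented_hausdorff (R : comNzRingType) :
  complemented R -> hausdorff_space (Spec R).
Proof.
move=> cR; rewrite open_hausdorff => P Q /eqP PQ.
have [a Pa nQa] : exists2 a, prime_set P a & ~ prime_set Q a.
  apply: contrapT => nPQ; apply/PQ/complemented_spec_eq => // a Pa.
  by apply: contrapT => nQa; apply: nPQ; exists a.
have [b bP] := cR a.
exists ([set P' : Spec R | ~ prime_set P' b],
        [set P' : Spec R | ~ prime_set P' a]) => /=.
  by rewrite !inE /=; split=> // /bP.
split; [exact: basic_open_open | exact: basic_open_open |].
by apply/eqP/seteqP; split=> // P' [/= nb /bP].
Qed.

(** The limit of an ultrafilter [F] on Spec(R). Primality is where maximality
    of [F] enters: the set of primes containing [x * y] is the union of those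
    containing [x] and those containing [y]. *)
Lemma ultra_prime (R : comNzRingType) (F : set_system (Spec R)) :
  UltraFilter F -> is_prime_ideal [set a : R | F [set P | prime_set P a]].
Proof.
move=> FU; have FP : ProperFilter F := ultra_proper; split; first split=> /=.
- by apply: filterE => P; have [[]] := prime_setP P.
- move=> x y; apply: filterS2 => P.
  by have [[_ PD _] _ _] := prime_setP P; exact: PD.
- move=> a x; apply: filterS => P.
  by have [[_ _ PM] _ _] := prime_setP P; exact: PM.
- by move=> /filter_ex[P P1]; have [_ + _] := prime_setP P; apply.
- move=> x y /= Fxy.
  have [|FnX] := in_ultra_setVsetC [set P : Spec R | prime_set P x] FU;
    first by left.
  right; apply: filterS2 FnX Fxy => P /= nPx.
  by have [_ _ Pm] := prime_setP P; move=> /Pm[].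
Qed.

(** The limit prime of an ultrafilter concentrated on V(I) contains [I]. It is a
    limit because each [a] outside it lies outside [F]-almost every prime. *)
Lemma zariski_V_compact (R : comNzRingType) (I : set R) :
  compact (zariski_V I).
Proof.
rewrite compact_ultra => F FU FI.
have FP : ProperFilter F := ultra_proper.
exists (MkSpec (ultra_prime FU)); split.
  by move=> a Ia /=; apply: filterS FI => P; exact.
move=> U; rewrite nbhsE => -[B [[J Jid ->] /= nJ] BU].
have [a Ja nFa] : exists2 a, J a & ~ F [set P : Spec R | prime_set P a].
  apply: contrapT => nE; apply: nJ => a Ja /=.
  by apply: contrapT => nFa; apply: nE; exists a.
have [//|] := in_ultra_setVsetC [set P : Spec R | prime_set P a] FU.
by apply: filterS => P /= nPa; apply: BU => /= JP; exact/nPa/JP.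
Qed.

(** The equivalence of the two forms of compactness concerns pointed spaces;
    Spec(R) gets a point from [Spec_inhabited], as [R] is not the zero ring. *)
Lemma Spec_compact_cover (R : comNzRingType) (A : set (Spec R)) :
  compact A <-> cover_compact A.
Proof.
have [P _] := cid (Spec_inhabited R).
pose T : ptopologicalType := HB.pack (Spec R) (isPointed.Build (Spec R) P).
by have -> : compact A = @cover_compact T A by rewrite -(@compact_cover T).
Qed.

(** * Prime avoidance *)

Lemma zariski_V_PA_property (R : comNzRingType) (J : set R) :
  is_ideal J -> PA_property (zariski_V J).
Proof.
move=> Jid I Iid IV.
have [||P sumP] := @exists_prime_above R (ideal_sum I J).
- exact: ideal_sum_ideal.
- move=> [i /IV[P JP Pi] [j /JP Pj E]].
  have [[_ PD _] P1 _] := prime_setP P.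
  by apply: P1; rewrite E; exact: PD.
exists P; apply: subset_trans sumP; first exact: ideal_sum_subr.
exact: ideal_sum_subl.
Qed.

Lemma complemented_PA_zariski_V (R : comNzRingType) (A : set (Spec R)) :
  complemented R -> PA_property A ->
  exists2 I : set R, is_ideal I & A = zariski_V I.
Proof.
move=> cR PA; exists (\bigcap_(P in A) (P : set R)).
  split=> [P _|x y Ix Iy P AP|a x Ix P AP];
    have [[P0 PD PM] _ _] := prime_setP P.
  - exact: P0.
  - by apply: PD; [exact: Ix | exact: Iy].
  - by apply: PM; exact: Ix.
apply/seteqP; split=> M; first by move=> AM x; exact.
move=> capM; have [Mid _ _] := prime_setP M.
have [a Ma|P AP MP] := PA M Mid; last by rewrite (complemented_spec_eq cR MP).
apply: contrapT => nA; have [b bP] := cR a.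
have /bP : prime_set M b; last exact.
by apply: capM => P AP; apply/bP => Pa; apply: nA; exists P.
Qed.

Theorem corollary2p9 (R : comNzRingType) :
  (von_neumann_regular R -> zero_dimensional_ring R) /\
  (zero_dimensional_ring R -> forall A : set (Spec R),
    [/\ PA_property A <-> cover_compact A,
        cover_compact A <-> closed A &
        closed A <-> exists2 I : set R, is_ideal I & A = zariski_V I]).
Proof.
split.
  move=> vR; apply: complemented_zero_dimensional.
  exact: von_neumann_regular_complemented.
move=> /zero_dimensional_complemented cR A.
have compact_closedP : cover_compact A <-> closed A.
  rewrite -Spec_compact_cover; split.
    by apply: compact_closed; exact: complemented_hausdorff.
  by move=> /zariski_closedP[I _ ->]; exact: zariski_V_compact.
split=> //; last exact: zariski_closedP.
rewrite compact_closedP zariski_closedP; split.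
  exact: complemented_PA_zariski_V.
by move=> [I Iid ->]; exact: zariski_V_PA_property.
Qed.
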